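(* Let $r$ be a positive integer and $k\ge 2$ an integer. Let $G$ be an $n$-vertex graph with $n\ge 2$ whose distance-$r$ balanced separator number is at most $k$. Then $G$ has a tree decomposition whose every bag is $(k(\log n+2),r)$-coverable.
   Context: Graphs are finite, simple, unweighted, with shortest-path distance $\mathrm{dist}_G$; logarithms are base 2. A vertex set $A$ is $(k,r)$-coverable if there are $k$ balls $\mathrm{Ball}_G(u,r)=\{v:\mathrm{dist}_G(u,v)\le r\}$ in $G$ whose union contains $A$. For $\mu:V(G)\to\mathbb{R}_{\ge0}$, $X\subseteq V(G)$ is a balanced separator for $\mu$ if every connected component $C$ of $G-X$ has $\mu(V(C))\le\frac12\mu(V(G))$. The distance-$r$ balanced separator number of $G$ is the smallest $k$ such that every weight function $\mu:V(G)\to\mathbb{R}_{\ge0}$ admits a $(k,r)$-coverable balanced separator. *)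

(* Defs.v *)
From HB Require Import structures.
From mathcomp Require Import all_boot all_order all_algebra.
From mathcomp Require Import boolp reals exp.

Set Implicit Arguments.
Unset Strict Implicit.
Unset Printing Implicit Defensive.

Import Order.TTheory GRing.Theory Num.Theory.
Local Open Scope ring_scope.

Record graph := Graph {
  vertex :> finType;
  adj : rel vertex;
  adj_sym : symmetric adj;
  adj_irr : irreflexive adj }.

Section Graph.
Variable G : graph.
Implicit Types (u v : G) (A X C : {set G}) (r : nat).

Definition walk u v (n : nat) : bool :=
  [exists p : n.-tuple G, path (@adj G) u p && (last u p == v)].

Lemma walk_ex u v : connect (@adj G) u v -> exists n, walk u v n.
Proof.
case/connectP => p up ->; exists (size p).
by apply/existsP; exists (in_tuple p); rewrite up eqxx.
Qed.

(* [None] stands for an infinite distance. *)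
Definition dist u v : option nat :=
  match boolP (connect (@adj G) u v) with
  | AltTrue uv => Some (ex_minn (walk_ex uv))
  | AltFalse _ => None
  end.

Definition ball u r : {set G} :=
  [set v | if dist u v is Some d then (d <= r)%N else false].

Lemma mem_ball u r : u \in ball u r.
Proof.
rewrite inE /dist; case: {-}_ / boolP => [uu|]; last by rewrite connect0.
case: ex_minnP => m _ /(_ 0%N) m0; apply: leq_trans (leq0n r); apply: m0.
by apply/existsP; exists [tuple]; rewrite /= eqxx.
Qed.

(* The number of balls is bounded by a real number, which need not be an
   integer. *)
Definition coverable (R : realType) (k : R) r A : Prop :=
  exists2 U : {set G}, #|U|%:R <= k & A \subset \bigcup_(u in U) ball u r.

Definition induced A : rel G := [rel u v | [&& u \in A, v \in A & adj u v]].

Definition components A : {set {set G}} :=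
  equivalence_partition (connect (induced A)) A.

Definition balanced_separator (R : realType) (mu : G -> R) X : Prop :=
  forall C, C \in components (~: X) ->
    \sum_(v in C) mu v <= 2^-1 * \sum_v mu v.

Definition admits_separators (R : realType) r (k : nat) : Prop :=
  forall mu : G -> R, (forall v, 0 <= mu v) ->
    exists2 X, coverable (k%:R : R) r X & balanced_separator mu X.

Lemma admits_separators_ex (R : realType) r :
  exists k, `[< admits_separators R r k >].
Proof.
exists #|G|; apply/asboolP => mu _; exists setT.
  exists setT; first by rewrite cardsT.
  by apply/subsetP => u _; apply/bigcupP; exists u; [rewrite inE | exact: mem_ball].
by move=> C /imsetP[x]; rewrite setCT inE.
Qed.

Definition connected_in A : Prop :=
  {in A &, forall u v, connect (induced A) u v}.

(* Adjacency being symmetric, an edge traversed back and forth is a [ucycle]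
   of size 2; genuine cycles have size at least 3. *)
Definition is_tree : Prop :=
  [/\ (0 < #|G|)%N, connected_in [set: G] &
      forall c : seq G, ucycle (@adj G) c -> (size c < 3)%N].

End Graph.

Definition separator_number (R : realType) (G : graph) (r : nat) : nat :=
  ex_minn (@admits_separators_ex G R r).

Definition tree_decomposition (G T : graph) (bag : T -> {set G}) : Prop :=
  [/\ is_tree T,
      forall v : G, exists t, v \in bag t,
      forall u v : G, adj u v -> exists2 t, u \in bag t & v \in bag t &
      forall v : G, connected_in [set t | v \in bag t]].

Definition log2 (R : realType) (x : R) : R := ln x / ln 2.

(* Main.v *)
(** Elimination tree: starting from C = V(G), take a balanced separator X for
    the indicator function of C and recurse into the components of C - X.  Each
    of them has at most |C|/2 vertices, so the recursion has depth at most
    log n + 1.  The bag of a node is the union of the sets X ∩ C over its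
    ancestors, itself included.  Cutting X down to C is what makes the nodes
    whose bag contains a given vertex connected: these are the descendants of
    the unique node at which the vertex is removed. *)
Require Import Defs.
From HB Require Import structures.
From mathcomp Require Import all_boot all_order all_algebra.
From mathcomp Require Import boolp reals exp.

Set Implicit Arguments.
Unset Strict Implicit.
Unset Printing Implicit Defensive.

Import Order.TTheory GRing.Theory Num.Theory.
Local Open Scope ring_scope.

(** * Connectivity in induced subgraphs *)

Lemma induced_sym (G : graph) (A : {set G}) : symmetric (induced A).
Proof. by move=> u v; rewrite /induced /= adj_sym andbCA. Qed.

Lemma connect_induced_sym (G : graph) (A : {set G}) :
  connect_sym (induced A).
Proof. exact/sym_connect_sym/induced_sym. Qed.

Lemma connect_inducedS (G : graph) (A B : {set G}) :
  A \subset B -> subrel (connect (induced A)) (connect (induced B)).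
Proof.
move=> sAB; apply: connect_sub => u v /and3P[uA vA uv].
by apply: connect1; rewrite /induced /= !(subsetP sAB) ?uA.
Qed.

Lemma connect_induced_mem (G : graph) (A : {set G}) (u v : G) :
  connect (induced A) u v -> (u \in A) = (v \in A).
Proof. by apply: closed_connect => {u v} u v /and3P[-> ->]. Qed.

Lemma component_of (G : graph) (A : {set G}) (v : G) : v \in A ->
  [set w in A | connect (induced A) v w] \in components A.
Proof. by move=> vA; apply/imsetP; exists v. Qed.

(** * Trees given by a parent map *)

Section RootedTree.
Variables (T : finType) (root : T) (par : T -> T) (height : T -> nat).
Hypothesis height_par :
  forall t, t != root -> (height (par t) < height t)%N.

(** As [par] is total, the guards discard its value at [root]; [par root = root] would otherwise
    give a loop. *)
Definition child_or_parent : rel T :=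
  [rel s t | (s != root) && (par s == t) || (t != root) && (par t == s)].

Lemma child_or_parent_sym : symmetric child_or_parent.
Proof. by move=> s t; rewrite /child_or_parent /= orbC. Qed.

Lemma child_or_parent_irr : irreflexive child_or_parent.
Proof.
move=> t; apply/negbTE; rewrite /child_or_parent /= orbb.
apply/andP => -[/height_par + /eqP E].
by rewrite E ltnn.
Qed.

Definition rooted_tree : graph :=
  Graph child_or_parent_sym child_or_parent_irr.

(** Taking parents stays in [A] and lowers [height], so the climb from any node of [A] ends at
    [top]. *)
Lemma connected_in_rooted_tree (A : {set rooted_tree}) (top : T) :
  (forall t, t \in A -> t != top -> t != root /\ par t \in A) ->
  connected_in A.
Proof.
move=> HA; suff to_top t : t \in A -> connect (induced A) t top.
  move=> s t sA tA; apply: connect_trans (to_top _ sA) _.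
  by rewrite connect_induced_sym to_top.
have [n] := ubnP (height t); elim: n t => // n IHn t ltn tA.
have [->|t_top] := eqVneq t top; first exact: connect0.
have [t_root ptA] := HA _ tA t_top.
apply: (connect_trans (y := par t)).
  apply: connect1; rewrite /induced /= tA ptA /child_or_parent /=.
  by rewrite t_root eqxx.
by apply: IHn => //; apply: leq_trans (height_par t_root) ltn.
Qed.

(* On a cycle, both neighbours of a node of maximal height are its parent. *)
Lemma rooted_tree_acyclic (c : seq rooted_tree) :
  ucycle (@adj rooted_tree) c -> (size c < 3)%N.
Proof.
case: c => // t0 c0; set c := t0 :: c0 => cyc.
have t0c : t0 \in c by rewrite mem_head.
case: (arg_maxnP height t0c) => t tc max_t.
have [i p rot_c] := rot_to tc.
have in_c x : x \in t :: p -> (height x <= height t)%N.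
  by rewrite -rot_c mem_rot; apply: max_t.
rewrite -(size_rot i) rot_c.
have /andP[] : ucycle (@adj rooted_tree) (t :: p) by rewrite -rot_c rot_ucycle.
have parE x : x \in t :: p -> child_or_parent t x -> par t = x.
  move=> /in_c le_xt /orP[/andP[_ /eqP //]|/andP[/height_par + /eqP E]].
  by rewrite E ltnNge le_xt.
case: p {rot_c} in_c parE => // x p in_c parE.
rewrite /cycle rcons_path => /andP[/= /andP[tx _] lt] /and3P[_ xp _].
have Ex : par t = x by apply: parE tx; rewrite !inE eqxx orbT.
have El : par t = last x p.
  apply: parE; first by rewrite inE mem_last orbT.
  by rewrite child_or_parent_sym.
(* Uniqueness lets [x] equal [last x p] only if [p] is empty, that is, if the cycle has size 2. *)
move: El xp; rewrite Ex; case: p {in_c parE lt} => //= y p {1}->.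
by rewrite mem_last.
Qed.

Lemma rooted_tree_is_tree : is_tree rooted_tree.
Proof.
split; [by apply/card_gt0P; exists root| |exact: rooted_tree_acyclic].
by apply: (@connected_in_rooted_tree _ root) => t _ ->; rewrite inE.
Qed.

End RootedTree.

(** * The elimination tree and its bags *)

Section Elimination.
Variables (G : graph) (S : {set G} -> {set G}).
Implicit Types (u v w : G) (i j : nat).

(* The node of depth [i] containing [v], empty if [v] has been removed at a
   smaller depth. *)
Fixpoint part i v : {set G} :=
  if i is j.+1 then
    [set w in part j v :\: S (part j v)
      | connect (induced (part j v :\: S (part j v))) v w]
  else setT.

Lemma part_sub i j v : (i <= j)%N -> part j v \subset part i v.
Proof.
move=> /subnK <-; elim: (j - i)%N => // d IH; apply: subset_trans IH.
by apply/subsetP => w; rewrite addSn /= !inE => /andP[/andP[]].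
Qed.

Lemma part_eq i v w : w \in part i v -> part i w = part i v.
Proof.
elim: i v w => //= i IH v w; rewrite inE => /andP[wP vw].
have wi : w \in part i v by move: wP; rewrite inE => /andP[].
rewrite (IH _ _ wi); apply/setP => x; rewrite !inE.
by rewrite (same_connect (@connect_induced_sym _ _) vw).
Qed.

Lemma part_eq_le i j v w : (i <= j)%N -> w \in part j v -> part i w = part i v.
Proof. by move=> /part_sub /subsetP sij /sij /part_eq. Qed.

Lemma part_self i v w : w \in part i v -> v \in part i v.
Proof.
case: i => [|i]; first by rewrite !inE.
rewrite inE => /andP[wP vw]; rewrite inE connect0 andbT.
by rewrite (connect_induced_mem vw).
Qed.

Hypothesis S_balanced : forall C K : {set G},
  K \in components (~: S C) -> (2 * #|K :&: C| <= #|C|)%N.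

(** With [C = part i v], the next part lies in [K :&: C] for [K] the component of [v] in [~: S C],
    so each level halves the size. *)
Lemma card_part i v : (2 ^ i * #|part i v| <= #|G|)%N.
Proof.
elim: i => [|i IH]; first by rewrite mul1n cardsT.
apply: leq_trans IH; rewrite expnSr -mulnA leq_mul2l; apply/orP; right.
have [->|[w /part_self]] := set_0Vmem (part i.+1 v); first by rewrite cards0.
rewrite inE => /andP[/setDP[_ vS] _].
apply: leq_trans (S_balanced (component_of _ : _ \in components _)); last first.
  by rewrite inE; exact: vS.
rewrite leq_mul2l /=; apply/subset_leq_card/subsetP => x.
rewrite inE => /andP[/setDP[xC xS] vx]; rewrite !inE xC xS andbT /=.
by apply: connect_inducedS vx; apply/subsetP => y; rewrite !inE => /andP[].
Qed.

Let depth := trunc_log 2 #|G|.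

Lemma part_eq0 v : part depth.+1 v = set0.
Proof.
apply/eqP; rewrite -cards_eq0 -leqn0 leqNgt; apply/negP => p_gt0.
have := leq_trans (leq_pmulr _ p_gt0) (card_part depth.+1 v).
by rewrite leqNgt trunc_log_ltn.
Qed.

Lemma removed_ex v : exists i, v \notin part i.+1 v.
Proof. by exists depth; rewrite part_eq0 inE. Qed.

Definition removal v := ex_minn (removed_ex v).

Lemma removal_le v : (removal v <= depth)%N.
Proof.
by rewrite /removal; case: ex_minnP => i _; apply; rewrite part_eq0 inE.
Qed.

Lemma mem_part_self i v : (v \in part i v) = (i <= removal v)%N.
Proof.
rewrite /removal; case: ex_minnP => m vm min_m; apply/idP/idP => [vi|le_im].
  rewrite leqNgt; apply: contra vm => lt_mi.
  exact: subsetP (part_sub v lt_mi) v vi.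
case: i le_im => [|i lt_im]; first by rewrite inE.
by apply: contraLR lt_im => /min_m; rewrite -leqNgt.
Qed.

(** Since [v] is connected to itself, it leaves its part after depth [i] only by lying in
    [S (part i v)]. *)
Lemma mem_S_removal i v :
  (v \in part i v :&: S (part i v)) = (i == removal v).
Proof.
rewrite eqn_leq inE mem_part_self; case: leqP => //= le_i.
have := mem_part_self i.+1 v; rewrite /= !inE connect0 andbT mem_part_self le_i.
by rewrite andbT => vS; rewrite leqNgt -vS negbK.
Qed.

(** An edge keeps its ends in one component as long as both survive. *)
Lemma part_adj i u v : adj u v ->
  (i <= removal u)%N -> (i <= removal v)%N -> part i u = part i v.
Proof.
move=> uv; elim: i => // i IH iu iv; apply: part_eq.
have E := IH (ltnW iu) (ltnW iv).
move: (iu) (iv); rewrite -!mem_part_self /= -E !inE !connect0 !andbT => uP vP.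
by rewrite uP connect_induced_sym connect1 // /induced /= !inE uP vP.
Qed.

(* A node of the elimination tree is represented by every pair [(i, v)] with
   [v] in it; the pairs other than [(i, rep i v)] hang below the latter as
   leaves with the same bag.  Pairs with an empty part are nodes too: they add
   no new vertex to the bag of [(i.-1, v)], below which they hang. *)
Definition node : Type := ('I_depth.+1 * G)%type.

(** On an empty part, the default makes [v] its own representative. *)
Definition rep i v : G := odflt v [pick w in part i v].

Lemma part_rep i j v : (i <= j)%N -> part i (rep j v) = part i v.
Proof.
by move=> le_ij; rewrite /rep; case: pickP => //= w /(part_eq_le le_ij).
Qed.

Lemma rep_eq i v w : w \in part i v -> rep i w = rep i v.
Proof.
by move=> wv; rewrite /rep (part_eq wv); case: pickP => // /(_ w); rewrite wv.
Qed.

Lemma repK i v : rep i (rep i v) = rep i v.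
Proof.
have [E|/rep_eq //] : rep i v = v \/ rep i v \in part i v; last by rewrite !E.
by rewrite /rep; case: pickP => [w|]; [right|left].
Qed.

Definition node_par (t : node) : node :=
  if t.2 == rep t.1 t.2 then (inord t.1.-1, t.2) else (t.1, rep t.1 t.2).

(** Doubling leaves odd heights for non-representatives, which lie above the representative of their
    own depth and below those of the next. *)
Definition node_height (t : node) : nat := t.1.*2 + (t.2 != rep t.1 t.2).

(** Since [part 0 v] is [setT], this is the same node for every [v]. *)
Definition node_root (v : G) : node := (ord0, rep 0 v).

Lemma node_height_par v (t : node) : t != node_root v ->
  (node_height (node_par t) < node_height t)%N.
Proof.
case: t => i w; rewrite /node_par /node_height /=.
have [wrep|wrep _] := eqVneq w (rep i w); last by rewrite repK eqxx addn0 addn1.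
have [i0|i_gt0 _] := posnP i.
  have {}i0 : i = ord0 by exact: val_inj.
  case/eqP; rewrite /node_root i0; congr pair; rewrite wrep i0.
  by rewrite (@rep_eq 0 v w) ?inE.
rewrite inordK /=; last exact: leq_ltn_trans (leq_pred _) (ltn_ord i).
rewrite addn0 -[in ltnRHS](prednK i_gt0) doubleS ltnS.
by rewrite -[leqRHS]addn1 leq_add2l leq_b1.
Qed.

Definition elimination_tree (v : G) : graph :=
  rooted_tree (@node_height_par v).

Definition node_bag (t : node) : {set G} :=
  \bigcup_(j < t.1.+1) (part j t.2 :&: S (part j t.2)).

(** If [u] is in [part j v], that part is [part j u], whose separator contains [u] only for
    [j = removal u]. *)
Lemma mem_node_bag (i : 'I_depth.+1) u v :
  (u \in node_bag (i, v)) = (removal u <= i)%N && (u \in part (removal u) v).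
Proof.
apply/bigcupP/andP => [[j _ /= uj]|[le_ui uv]].
  have uv : u \in part j v by move: uj; rewrite inE => /andP[].
  move: uj; rewrite -(part_eq uv) mem_S_removal => /eqP <-.
  by rewrite -ltnS.
have le_ui' : (removal u < i.+1)%N by [].
by exists (Ordinal le_ui') => //=; rewrite -(part_eq uv) mem_S_removal.
Qed.

Lemma elimination_tree_decomposition (v0 : G) :
  @tree_decomposition G (elimination_tree v0) node_bag.
Proof.
have lt_removal v : (removal v < depth.+1)%N by rewrite ltnS removal_le.
split; first exact: rooted_tree_is_tree.
- move=> v; exists (Ordinal (lt_removal v), v).
  by rewrite mem_node_bag leqnn mem_part_self leqnn.
(* The node removing the later end of the edge lies below the one removing the other end, so its bag
   has both. *)
- move=> u v; wlog le_uv : u v / (removal u <= removal v)%N => [hw uv|uv].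
    have [/hw|/ltnW /hw] := leqP (removal u) (removal v); first exact.
    by rewrite adj_sym => /(_ uv)[t vt ut]; exists t.
  exists (Ordinal (lt_removal v), v); rewrite mem_node_bag /=.
    by rewrite le_uv -(part_adj uv) // mem_part_self leqnn.
  by rewrite leqnn mem_part_self leqnn.
move=> u; pose top : node := (Ordinal (lt_removal u), rep (removal u) u).
apply: (connected_in_rooted_tree (top := top)) => -[i v].
rewrite inE mem_node_bag => /andP[le_ui uv] ne_top; split.
  (* At the root, [i = 0] forces [removal u = 0], and the root is then [top]. *)
  apply: contra ne_top => /eqP[i0 vE]; apply/eqP.
  have u0 : removal u = 0%N.
    by apply/eqP; rewrite -leqn0 -[0%N]/(val (@ord0 depth)) -i0.
  rewrite /top; congr pair; first by apply: val_inj; rewrite i0 /= u0.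
  by rewrite vE u0 (@rep_eq 0 v0 u) ?inE.
rewrite inE /node_par /=; case: ifPn => [/eqP vrep|_]; last first.
  by rewrite mem_node_bag le_ui part_rep.
(* A representative at depth [removal u] would be [top]; strictness keeps depth [i.-1] at or beyond
   [removal u]. *)
have lt_ui : (removal u < i)%N.
  rewrite ltn_neqAle le_ui andbT; apply: contra ne_top => /eqP uE; apply/eqP.
  rewrite /top; congr pair; first exact: val_inj.
  by rewrite vrep -uE (rep_eq uv).
rewrite mem_node_bag inordK ?uv ?andbT.
  by rewrite -ltnS (ltn_predK lt_ui).
exact: leq_ltn_trans (leq_pred _) (ltn_ord i).
Qed.

End Elimination.

(** * Coverability and balanced separators *)

Section Coverable.
Variables (G : graph) (R : realType) (r : nat).

Lemma coverableS (a b : R) (A B : {set G}) :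
  a <= b -> A \subset B -> coverable a r B -> coverable b r A.
Proof.
move=> ab AB [U Ua BU]; exists U; first exact: le_trans ab.
exact: subset_trans BU.
Qed.

Lemma coverable_bigcup (a : R) (m : nat) (A : 'I_m -> {set G}) :
  (forall j, coverable a r (A j)) ->
  coverable (a * m%:R) r (\bigcup_j A j).
Proof.
move=> covA; have /choice[U HU] : forall j, exists U : {set G},
    #|U|%:R <= a /\ A j \subset \bigcup_(u in U) ball u r.
  by move=> j; have [U Ua AU] := covA j; exists U.
exists (\bigcup_j U j).
  apply: (@le_trans _ _ (\sum_j #|U j|%:R)).
    rewrite -natr_sum ler_nat.
    elim/big_rec2: _ => [|j s B _ IH]; first by rewrite cards0.
    by apply: leq_trans (leq_card_setU _ _) _; rewrite leq_add2l.
  apply: le_trans (ler_sum _ (fun j _ => (HU j).1)) _.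
  by rewrite sumr_const card_ord mulr_natr.
apply/bigcupsP => j _; apply: subset_trans (HU j).2 _.
apply/bigcupsP => u uU; apply: (bigcup_sup u) => //.
by apply/bigcupP; exists j.
Qed.

(** Sums of the indicator of [C] are cardinalities, and the factor 2 clears the half. *)
Lemma balanced_separator_card (C X : {set G}) :
  balanced_separator (fun v => (v \in C)%:R : R) X ->
  forall K, K \in components (~: X) -> (2 * #|K :&: C| <= #|C|)%N.
Proof.
move=> bal K /bal.
rewrite -!natr_sum -big_mkcond /= sum1_card.
rewrite -big_mkcondr /= sum1dep_card ler_pdivlMl // -natrM ler_nat.
by congr (2 * _ <= _)%N; apply: eq_card => v; rewrite !inE.
Qed.

Lemma separator_number_spec :
  @admits_separators G R r (separator_number R G r).
Proof. by rewrite /separator_number; case: ex_minnP => k /asboolP. Qed.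

End Coverable.

Lemma trunc_log_le_log2 (R : realType) (n : nat) : (0 < n)%N ->
  (trunc_log 2 n)%:R <= log2 (n%:R : R).
Proof.
move=> n_gt0; have ln2 : 0 < ln (2 : R) by rewrite ln_gt0 // ltr1n.
rewrite /log2 ler_pdivlMr // mulr_natl -lnXn //.
by rewrite ler_ln ?posrE ?exprn_gt0 ?ltr0n // -natrX ler_nat trunc_logP.
Qed.

Theorem theorem1p3 (R : realType) (r k : nat) (G : graph)
    (hr : (0 < r)%N) (hk : (2 <= k)%N) (hn : (2 <= #|G|)%N)
    (hG : (separator_number R G r <= k)%N) :
  exists (T : graph) (bag : T -> {set G}),
    tree_decomposition bag /\
    forall t : T, coverable (k%:R * (log2 (#|G|%:R : R) + 2)) r (bag t).
Proof.
have /choice[S HS] : forall C : {set G}, exists X : {set G},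
    coverable (k%:R : R) r X /\
    balanced_separator (fun v => (v \in C)%:R : R) X.
  move=> C.
  have [//|X covX balX] := @separator_number_spec G R r (fun v => (v \in C)%:R).
  by exists X; split=> //; apply: coverableS covX; rewrite ?ler_nat.
have S_bal C := balanced_separator_card (HS C).2.
have /card_gt0P[v0 _] : (0 < #|G|)%N by exact: ltnW.
exists (elimination_tree S v0), (@node_bag G S).
split=> [|[i v]]; first exact: elimination_tree_decomposition.
apply: (coverableS _ (subxx _)) (coverable_bigcup _) => /=; last first.
  by move=> j; apply: coverableS (lexx _) (subsetIr _ _) (HS _).1.
(* A bag at depth [i] is a union of [i.+1] sets needing at most [k] balls each, and [i] is at most
   the integer part of [log n]. *)
rewrite ler_wpM2l // -natr1.
apply: lerD; last by rewrite ler1n.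
apply: le_trans (trunc_log_le_log2 R (ltnW hn)).
by rewrite ler_nat -ltnS.
Qed.
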